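(* There is an absolute constant $c>0$ such that for every $\epsilon\in(0,1]$ the following holds for every instance of the B-bounded single-minded multi-unit combinatorial auction problem with $B\ge c\,\frac{\ln m}{\epsilon^2}$: algorithm Bounded-MUCA$(\epsilon/6)$ returns a feasible $\big((1+\epsilon)\frac{e}{e-1}\big)$-approximate solution, runs in polynomial time, and is monotone and exact with respect to the value of each request.
   Context: Single-minded multi-unit combinatorial auction problem: the input is a set $U$ of $m$ non-identical items, each item $u$ having a positive integer multiplicity $c_u$, and a set $\mathcal{R}$ of requests, each $r$ given by a bundle $U_r\subseteq U$ and a value $v_r>0$. A feasible solution is a subset $S\subseteq\mathcal{R}$ such that every item $u$ belongs to at most $c_u$ of the bundles $U_r$, $r\in S$; its value is $\sum_{r\in S}v_r$. $B=\min_u c_u$ (B-bounded problem). A solution is $\rho$-approximate if it is feasible and has value at least $1/\rho$ times the optimum. Algorithm Bounded-MUCA$(\epsilon)$, $\epsilon\in(0,1]$: set $\mathcal{L}=\mathcal{R}$, $\mathcal{W}=\emptyset$, $y_u=1/c_u$ for all $u\in U$. While $\mathcal{L}\ne\emptyset$ and $\sum_{u\in U}c_u y_u\le e^{\epsilon(B-1)}$: let $\hat r\in\mathcal{L}$ minimize $\frac{1}{v_r}\sum_{u\in U_r}y_u$; for all $u\in U_{\hat r}$ set $y_u\leftarrow y_u\cdot e^{\epsilon B/c_u}$; add $\hat r$ to $\mathcal{W}$ and remove it from $\mathcal{L}$. Output $\mathcal{W}$. An algorithm is monotone w.r.t. the value of request $r$ if whenever it selects $r$ when $r$ has value $v_r$,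 it also selects $r$ when $r$ has any value $\tilde v_r\ge v_r$, all other requests fixed. It is exact if each selected request is allocated exactly its bundle and unselected requests are allocated nothing. *)

(* Defs.v *)
From HB Require Import structures.
From mathcomp Require Import all_boot all_order all_algebra.
From mathcomp Require Import reals sequences exp.

Set Implicit Arguments.
Unset Strict Implicit.
Unset Printing Implicit Defensive.

Import Order.TTheory GRing.Theory Num.Theory.
Local Open Scope ring_scope.

(* Requests are numbered 0, ..., n-1, so that two distinct requests may have
   the same bundle and the same value.  A bundle may be empty. *)
Record instance (R : realType) (m n : nat) := Instance {
  mult : 'I_m -> nat;
  bundle : 'I_n -> {set 'I_m};
  value : 'I_n -> R;
  items_gt0 : (0 < m)%N;
  mult_gt0 : forall u, (0 < mult u)%N;
  value_gt0 : forall r, 0 < value r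
}.

Definition item0 (R : realType) (m n : nat) (I : instance R m n) : 'I_m :=
  Ordinal (items_gt0 I).

(* The capacity bound B of the B-bounded problem. *)
Definition min_mult (R : realType) (m n : nat) (I : instance R m n) : nat :=
  mult I [arg min_(u < item0 I) mult I u].

Definition feasible (R : realType) (m n : nat) (I : instance R m n)
    (S : {set 'I_n}) : bool :=
  [forall u, (#|[set r in S | u \in bundle I r]| <= mult I u)%N].

Definition total_value (R : realType) (m n : nat) (I : instance R m n)
    (S : {set 'I_n}) : R := \sum_(r in S) value I r.

(* The default 0 of the maximum is harmless: set0 is feasible, of value 0. *)
Definition optimum (R : realType) (m n : nat) (I : instance R m n) : R :=
  \big[Num.max/0]_(S : {set 'I_n} | feasible I S) total_value I S.

Definition approximate (R : realType) (m n : nat) (rho : R)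
    (I : instance R m n) (S : {set 'I_n}) : Prop :=
  feasible I S /\ rho^-1 * optimum I <= total_value I S.

(* A mechanism outputs the selected requests and what each request receives. *)
Record outcome (m n : nat) := Outcome {
  selected : {set 'I_n};
  allocated : {ffun 'I_n -> {set 'I_m}}
}.

Definition exact_outcome (R : realType) (m n : nat) (I : instance R m n)
    (o : outcome m n) : Prop :=
  forall r, (r \in selected o -> allocated o r = bundle I r) /\
            (r \notin selected o -> allocated o r = set0).

(* [alg I o] means that [o] is an output of the algorithm on [I].  The second
   instance differs from [I] only in the value of [r], which is not lower. *)
Definition monotone_at (R : realType) (m n : nat)
    (alg : instance R m n -> outcome m n -> Prop) (I : instance R m n)
    (r : 'I_n) : Prop :=
  forall I' : instance R m n,
    mult I' =1 mult I -> bundle I' =1 bundle I ->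
    (forall q, q != r -> value I' q = value I q) -> value I r <= value I' r ->
  forall o o', alg I o -> alg I' o' -> r \in selected o -> r \in selected o'.

(* Running time is the number of elementary operations in the exact real
   arithmetic model (unit cost): one arithmetic operation, exponential,
   comparison, or lookup or update of a single table entry (a subset being the
   table of its characteristic function) costs 1, and so does each round of a
   loop.  A value of type [costed A] is a result together with its cost. *)
Definition costed (A : Type) : Type := (A * nat)%type.

Definition ret (A : Type) (a : A) : costed A := (a, 0%N).

Definition op (A : Type) (a : A) : costed A := (a, 1%N).

Definition bind (A B : Type) (p : costed A) (f : A -> costed B) : costed B :=
  ((f p.1).1, (p.2 + (f p.1).2)%N).

Notation "'let!' x := p 'in' q" := (bind p (fun x => q))
  (at level 200, x name, p at level 200, q at level 200,
   format "'[v' 'let!'  x  :=  p  'in' '/' q ']'").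

Fixpoint for_each (T S : Type) (s : seq T) (body : T -> S -> costed S) (st : S) :
    costed S :=
  if s is x :: s' then
    let! st1 := op st in
    let! st2 := body x st1 in
    for_each s' body st2
  else ret st.

(* [while_loop cond body st st' t]: started in state [st], the loop stops in
   state [st'] after [t] operations. *)
Inductive while_loop (S : Type) (cond : S -> costed bool) (body : S -> costed S) :
    S -> S -> nat -> Prop :=
| While_stop (st : S) (t : nat) :
    cond st = (false, t) -> while_loop cond body st st t.+1
| While_step (st st1 st' : S) (t t1 t' : nat) :
    cond st = (true, t) -> body st = (st1, t1) ->
    while_loop cond body st1 st' t' ->
    while_loop cond body st st' (t + t1 + t').+1.

(* The sets L and W, the bundles handed out so far, and the weights y. *)
Record state (R : realType) (m n : nat) := State {
  pending : {set 'I_n};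
  winners : {set 'I_n};
  granted : {ffun 'I_n -> {set 'I_m}};
  weight : {ffun 'I_m -> R}
}.

Definition update (T : finType) (A : Type) (f : {ffun T -> A}) (x : T) (a : A) :
    {ffun T -> A} :=
  [ffun z => if z == x then a else f z].

Section BoundedMUCA.
Variables (R : realType) (m n : nat) (eps : R) (I : instance R m n).

Definition compute_bound : costed nat :=
  let! b0 := op (mult I (item0 I)) in
  for_each (enum 'I_m) (fun u b =>
    let! lt := op (mult I u < b)%N in
    if lt then op (mult I u) else ret b) b0.

Definition init_state : costed (state R m n) :=
  let! L := for_each (enum 'I_n) (fun r L => op (r |: L)) set0 in
  let! W := for_each (enum 'I_n) (fun r W => op (W :\ r)) set0 in
  let! g := for_each (enum 'I_n) (fun r g =>
              for_each (enum 'I_m) (fun u g =>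
                op (update g r (g r :\ u))) g) [ffun=> set0] in
  let! y := for_each (enum 'I_m) (fun u y =>
              let! v := op ((mult I u)%:R^-1) in
              op (update y u v)) [ffun=> 0] in
  ret (State L W g y).

Definition has_pending (st : state R m n) : costed bool :=
  for_each (enum 'I_n) (fun r b =>
    let! c := op (r \in pending st) in
    op (b || c)) false.

Definition total_weight (st : state R m n) : costed R :=
  for_each (enum 'I_m) (fun u acc =>
    let! x := op ((mult I u)%:R * weight st u) in
    op (acc + x)) 0.

Definition threshold (B : nat) : costed R :=
  let! b := op (B%:R - 1) in
  let! x := op (eps * b) in
  op (expR x).

Definition continue (B : nat) (st : state R m n) : costed bool :=
  let! nonempty := has_pending st in
  let! D := total_weight st in
  let! bnd := threshold B in
  let! low := op (D <= bnd) in
  op (nonempty && low).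

(* v_r^-1 * \sum_(u in U_r) y_u *)
Definition unit_price (st : state R m n) (r : 'I_n) : costed R :=
  let! s := for_each (enum 'I_m) (fun u acc =>
              let! b := op (u \in bundle I r) in
              if b then op (acc + weight st u) else ret acc) 0 in
  let! v := op ((value I r)^-1) in
  op (v * s).

(* The comparison is strict: among pending requests of minimal unit price, the
   one with the least number wins.  As the numbering of the requests of an
   instance is arbitrary, this covers every fixed order of tie-breaking (and,
   numbering the requests by time of selection, every run with ties broken
   arbitrarily). *)
Definition best_request (st : state R m n) : costed (option ('I_n * R)) :=
  for_each (enum 'I_n) (fun r best =>
    let! b := op (r \in pending st) in
    if b then
      let! p := unit_price st r in
      if best is Some (_, p0) then
        let! lt := op (p < p0) in
        if lt then op (Some (r, p)) else ret best
      else op (Some (r, p))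
    else ret best) None.

(* [None] cannot occur as long as a request is pending. *)
Definition select (B : nat) (st : state R m n) : costed (state R m n) :=
  let! best := best_request st in
  if best is Some (r, _) then
    let! st1 := for_each (enum 'I_m) (fun u s =>
        let! b := op (u \in bundle I r) in
        if b then
          let! a := op (eps * B%:R) in
          let! x := op (a / (mult I u)%:R) in
          let! e := op (expR x) in
          let! v := op (weight s u * e) in
          let! y := op (update (weight s) u v) in
          let! g := op (update (granted s) r (u |: granted s r)) in
          ret (State (pending s) (winners s) g y)
        else ret s) st in
    let! W := op (r |: winners st1) in
    let! L := op (pending st1 :\ r) in
    ret (State L W (granted st1) (weight st1))
  else ret st.

Definition bounded_muca (o : outcome m n) (t : nat) : Prop :=
  exists st t',
    let: (B, t1) := compute_bound in
    let: (st0, t2) := init_state in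
    [/\ while_loop (continue B) (select B) st0 st t',
        o = Outcome (winners st) (granted st) &
        t = (t1 + t2 + t')%N].

End BoundedMUCA.

(* Main.v *)
(* With [k_u] the number of winners using item [u], the weight of [u] is always
   [exp (eps' B k_u / c_u) / c_u], where [eps' = eps / 6]; let [D] be the sum of
   the [c_u y_u].  A saturated item makes [D] exceed the threshold, whence
   feasibility.  For the value, fix a feasible set of value [T] and let [P] be
   the value collected so far.  Weak duality gives [alpha (T - P) <= D] for the
   current best price [alpha], and selecting a request of value [v] raises [D]
   by at most [K alpha v] with [K = eps' B / (1 - eps')].  Thus [ln D] grows by at
   most [K v / (T - P)], which telescopes to
   [ln D <= ln m + K (ln T - ln (T - P))].  When the loop stops with requests
   left, [ln D - ln m] is nearly [eps' B], so [T - P] is at most about [T / e].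
   For monotonicity, raising the value of [r] cannot change the run before [r]
   is selected. *)
Require Import Defs.
From HB Require Import structures.
From mathcomp Require Import all_boot all_order all_algebra.
From mathcomp Require Import reals sequences exp.
From mathcomp Require Import zify ring lra.

Set Implicit Arguments.
Unset Strict Implicit.
Unset Printing Implicit Defensive.

Import Order.TTheory GRing.Theory Num.Theory.
Local Open Scope ring_scope.

(** * Invariants, sums and costs of loops over all indices *)

(** [P k] describes the state after the rounds for the indices below [k]; the induction runs over
    the remaining suffix [drop k (enum 'I_n)]. *)
Lemma for_each_ord_ind (n : nat) (S : Type) (body : 'I_n -> S -> costed S)
    (P : nat -> S -> Prop) (s : S) :
  P 0%N s -> (forall (i : 'I_n) s, P i s -> P i.+1 (body i s).1) ->
  P n (for_each (enum 'I_n) body s).1.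
Proof.
move=> P0 Pstep.
suff gen d : forall k s, (k + d = n)%N -> P k s ->
    P n (for_each (drop k (enum 'I_n)) body s).1.
  by rewrite -[enum _]drop0; apply: (gen n).
elim: d => [|d IHd] k st eqn Pk.
  by rewrite drop_oversize ?size_enum_ord -?eqn ?addn0 // -[X in P X]eqn addn0.
have ltkn : (k < n)%N by rewrite -eqn addnS ltnS leq_addr.
rewrite (drop_nth (Ordinal ltkn)) ?size_enum_ord //=.
rewrite [nth _ _ _](nth_ord_enum (Ordinal ltkn) (Ordinal ltkn)).
by apply: IHd; [rewrite addSnnS | apply: (Pstep (Ordinal ltkn))].
Qed.

Lemma for_each_sum (R : nmodType) (n : nat) (body : 'I_n -> R -> costed R)
    (F : 'I_n -> R) :
  (forall i x, (body i x).1 = x + F i) ->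
  (for_each (enum 'I_n) body 0).1 = \sum_i F i.
Proof.
move=> bodyE.
pose P k x := x = \sum_(i < n | (i < k)%N) F i.
have -> : (for_each (enum 'I_n) body 0).1 = \sum_(i < n | (i < n)%N) F i.
  apply: (@for_each_ord_ind _ _ _ P) => [|i x Px].
    by rewrite /P big1.
  rewrite bodyE Px /P [RHS](bigD1 i) //= addrC; congr (_ + _).
  by apply: eq_bigl => j; rewrite ltnS ltn_neqAle andbC.
by apply: eq_bigl => i; rewrite ltn_ord.
Qed.

Lemma for_each_ord_cost (n : nat) (S : Type) (k : nat)
    (body : 'I_n -> S -> costed S) (st : S) :
  (forall i st, ((body i st).2 <= k)%N) ->
  ((for_each (enum 'I_n) body st).2 <= n * k.+1)%N.
Proof.
move=> body_le; rewrite -[in (n * _)%N](size_enum_ord n).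
elim: (enum 'I_n) st => //= i s IHs st.
by have := body_le i st; have := IHs (body i st).1; lia.
Qed.

Lemma ltn_ordS (k : nat) (i j : 'I_k) : (j < i.+1)%N = (j == i) || (j < i)%N.
Proof. by rewrite ltnS leq_eqVlt. Qed.

(** * The algorithm as a greedy process on the set of winners *)

Section Semantics.
Variables (R : realType) (m n : nat) (eps : R) (I : instance R m n).

Local Notation B := (min_mult I).

Definition load (W : {set 'I_n}) (u : 'I_m) : nat :=
  #|[set r in W | u \in bundle I r]|.

(** Closed form of [y_u]: it starts at [1 / c_u], and every winner using [u] multiplies it by
    [exp (eps B / c_u)]. *)
Definition item_weight (W : {set 'I_n}) (u : 'I_m) : R :=
  (mult I u)%:R^-1 * expR (eps * B%:R / (mult I u)%:R * (load W u)%:R).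

Definition potential (W : {set 'I_n}) : R :=
  \sum_u (mult I u)%:R * item_weight W u.

Definition price (W : {set 'I_n}) (r : 'I_n) : R :=
  (value I r)^-1 * \sum_(u in bundle I r) item_weight W u.

Definition active (W : {set 'I_n}) : bool :=
  (W != setT) && (potential W <= expR (eps * (B%:R - 1))).

(** Breaking ties by the least number leaves at most one best request, so two runs can be compared
    round by round. *)
Definition best (W : {set 'I_n}) (r : 'I_n) : Prop :=
  r \notin W /\ forall q, q \notin W ->
    price W r < price W q \/ price W r = price W q /\ (r <= q)%N.

Inductive greedy : {set 'I_n} -> {set 'I_n} -> Prop :=
| Greedy_stop W : ~~ active W -> greedy W W
| Greedy_step W r W' :
    active W -> best W r -> greedy (r |: W) W' -> greedy W W'.

Definition grants (W : {set 'I_n}) : {ffun 'I_n -> {set 'I_m}} :=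
  [ffun r => if r \in W then bundle I r else set0].

(* The set of winners determines the whole state of the algorithm. *)
Definition state_of (W : {set 'I_n}) : state R m n :=
  State (~: W) W (grants W) [ffun u => item_weight W u].

Lemma load_set0 u : load set0 u = 0%N.
Proof. by apply: eq_card0 => r; rewrite !inE. Qed.

Lemma min_mult_le u : (B <= mult I u)%N.
Proof. by rewrite /min_mult; case: arg_minnP => // v _; apply. Qed.

(** * Results of the subroutines *)

Lemma compute_bound_val : (compute_bound I).1 = B.
Proof.
(* The second conjunct, that [b] is one of the multiplicities, yields [B <= b]. *)
pose P k b := (forall u : 'I_m, (u < k)%N -> (b <= mult I u)%N) /\
              exists u, b = mult I u.
have [le_b [v eqb]] : P m (compute_bound I).1.
  apply: (@for_each_ord_ind m nat _ P) => [|i b [le_b [v eqb]]].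
    by split=> //; exists (item0 I).
  rewrite /=; case: ifP => /= [lt_ib|/negbT]; last first.
    rewrite -leqNgt => le_bi; split; last by exists v.
    move=> u; rewrite ltnS leq_eqVlt => /orP[/eqP/val_inj-> //|].
    exact: le_b.
  split; last by exists i.
  move=> u; rewrite ltnS leq_eqVlt => /orP[/eqP/val_inj-> //|/le_b].
  exact/leq_trans/ltnW.
apply/eqP; rewrite eqn_leq {2}eqb min_mult_le andbT.
exact: le_b.
Qed.

Lemma init_state_val : (init_state I).1 = state_of set0.
Proof.
rewrite /init_state /state_of /=; congr State.
- rewrite setC0.
  pose P k (L : {set 'I_n}) := L = [set r : 'I_n | (r < k)%N].
  suff -> : P n (for_each (enum 'I_n) (fun r L => op (r |: L)) set0).1.
    by apply/setP=> r; rewrite !inE ltn_ord.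
  apply: (@for_each_ord_ind n _ _ P) => [|i L ->]; apply/setP => r.
    by rewrite !inE.
  by rewrite !inE [RHS]leq_eqVlt.
- apply: (@for_each_ord_ind n _ _ (fun _ W => W = set0)) => // i W ->.
  exact: set0D.
- have -> : grants set0 = [ffun=> set0] by apply/ffunP=> r; rewrite !ffunE inE.
  apply: (@for_each_ord_ind n _ _ (fun _ g => g = [ffun=> set0])) => // r g ->.
  apply: (@for_each_ord_ind m _ _ (fun _ g => g = [ffun=> set0])) => // u g' ->.
  by apply/ffunP => q /=; rewrite !ffunE set0D if_same.
- pose P k (y : {ffun 'I_m -> R}) :=
    forall u : 'I_m, (u < k)%N -> y u = item_weight set0 u.
  apply/ffunP => u; rewrite [RHS]ffunE; move: u (ltn_ord u); rewrite -/(P m _).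
  apply: (@for_each_ord_ind m _ _ P) => // i y Py u.
  rewrite ltnS leq_eqVlt /= ffunE -val_eqE /=.
  have [/val_inj-> _|_] := eqVneq (val u) i; last exact: Py.
  by rewrite /item_weight load_set0 mulr0 expR0 mulr1.
Qed.

Lemma has_pending_val W : (has_pending (state_of W)).1 = (W != setT).
Proof.
pose P k b := b = [exists r : 'I_n, (r < k)%N && (r \notin W)].
have -> : P n (has_pending (state_of W)).1.
  apply: (@for_each_ord_ind n _ _ P) => [|i b ->] /=.
    by apply/esym/existsP; case.
  rewrite inE; apply/orP/existsP => [[/existsP[r /andP[lt_ri rW]]|iW]|].
  - by exists r; rewrite rW ltnS ltnW.
  - by exists i; rewrite iW ltnSn.
  case=> r /andP[]; rewrite ltnS leq_eqVlt => /orP[/eqP/val_inj-> ->|lt_ri rW].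
    by right.
  by left; apply/existsP; exists r; rewrite lt_ri.
rewrite -subTset; apply/existsP/subsetPn => [[r /andP[_ rW]]|[r _ rW]];
  by exists r; rewrite ?rW ?ltn_ord.
Qed.

Lemma total_weight_val W : (total_weight I (state_of W)).1 = potential W.
Proof.
by rewrite /total_weight; apply: for_each_sum => u x /=; rewrite ffunE.
Qed.

Lemma continue_val W : (continue eps I B (state_of W)).1 = active W.
Proof. by rewrite /continue /= has_pending_val total_weight_val. Qed.

Lemma unit_price_val W r : (unit_price I (state_of W) r).1 = price W r.
Proof.
rewrite /unit_price /price /= [in RHS]big_mkcond; congr (_ * _).
by apply: for_each_sum => u x /=; case: ifP; rewrite ?addr0 ?ffunE.
Qed.

Lemma best_request_val W :
  match (best_request I (state_of W)).1 with
  | Some (r, _) => best W r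
  | None => W = setT
  end.
Proof.
(* Invariant: the best pending request below [k] with its price; a later request of equal price
   never replaces it. *)
pose P k (o : option ('I_n * R)) := match o with
  | Some (r, p) => [/\ p = price W r, (r < k)%N, r \notin W &
      forall q : 'I_n, (q < k)%N -> q \notin W ->
        price W r < price W q \/ price W r = price W q /\ (r <= q)%N]
  | None => forall q : 'I_n, (q < k)%N -> q \in W
  end.
have : P n (best_request I (state_of W)).1.
  apply: (@for_each_ord_ind n _ _ P) => // i o Po.
  case: (unit_price I _ i) (unit_price_val W i) => _ c /= ->.
  rewrite inE; case: ifP => /= [iW|/negbFE iW]; last first.
    case: o Po => [[r p] [-> lt_ri rW Hr]|Po] /=.
      split=> // [|q]; first by rewrite ltnS ltnW.
      rewrite ltnS leq_eqVlt => /orP[/eqP/val_inj->|]; last exact: Hr.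
      by rewrite iW.
    move=> q; rewrite ltnS leq_eqVlt => /orP[/eqP/val_inj->|] //; exact: Po.
  case: o Po => [[r p] [-> lt_ri rW Hr]|Po] /=; last first.
    split=> // q; rewrite ltnS leq_eqVlt => /orP[/eqP/val_inj->|]; first by right.
    by move=> /Po ->.
  case: ltP => [lt_pi|le_pi] /=; split=> //.
  - move=> q; rewrite ltnS leq_eqVlt => /orP[/eqP/val_inj->|]; first by right.
    move=> lt_qi qW; left; apply: (lt_le_trans lt_pi).
    by case: (Hr q lt_qi qW) => [/ltW //|[-> _]].
  - by rewrite ltnS ltnW.
  move=> q; rewrite ltnS leq_eqVlt => /orP[/eqP/val_inj->|]; last exact: Hr.
  move=> _; move: le_pi; rewrite le_eqVlt => /orP[/eqP|]; last by left.
  by move=> ->; right; split=> //; apply: ltnW.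
case: (best_request _ _).1 => [[r p] [_ _ rW Hr]|HW]; last first.
  by apply/setP => q; rewrite inE HW.
by split=> // q; apply: Hr.
Qed.

Lemma load_sum (W : {set 'I_n}) u : load W u = (\sum_(r in W) (u \in bundle I r))%N.
Proof.
rewrite /load -sum1_card big_mkcond [RHS]big_mkcond /=.
by apply: eq_bigr => r _; rewrite inE; case: (r \in W); case: (u \in _).
Qed.

Lemma load_setU1 (W : {set 'I_n}) r u :
  r \notin W -> load (r |: W) u = ((u \in bundle I r) + load W u)%N.
Proof. by move=> rW; rewrite !load_sum big_setU1. Qed.

Lemma item_weight_setU1 (W : {set 'I_n}) r u : r \notin W ->
  item_weight (r |: W) u =
  item_weight W u * expR (eps * B%:R / (mult I u)%:R * (u \in bundle I r)%:R).
Proof.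
by move=> rW; rewrite /item_weight load_setU1 // natrD mulrDr expRD mulrCA mulrC.
Qed.

Lemma select_val W :
  W != setT ->
  exists2 r, best W r &
    (select eps I B (state_of W)).1 = state_of (r |: W).
Proof.
move=> WT; have := best_request_val W; rewrite /select /=.
case: (best_request _ _).1 => [[r p] br|/eqP]; last by rewrite (negPf WT).
exists r => //=; have [rW _] := br.
set body := fun u s => _.
(* After [k] rounds the items below [k] carry their weights for [r |: W], the others still those for
   [W]. *)
pose P k (s : state R m n) := s = State (~: W) W
  [ffun q => if q == r then [set u in bundle I r | (u < k)%N] else grants W q]
  [ffun u : 'I_m => item_weight (if (u < k)%N then r |: W else W) u].
have -> : P m (for_each (enum 'I_m) body (state_of W)).1.
  apply: for_each_ord_ind => [|i s ->].
    rewrite /P /state_of; congr State; apply/ffunP => q; rewrite !ffunE //.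
    case: eqP => // ->; rewrite (negPf rW); apply/setP => u.
    by rewrite !inE andbF.
  rewrite /body /= /P; case: ifP => /= ui; congr State; apply/ffunP => q;
    rewrite !ffunE ?eqxx.
  - case: eqP => // _; apply/setP => u; rewrite !inE ltn_ordS.
    by have [->|] := eqVneq u i; rewrite ?ui.
  - rewrite ltn_ordS; have [->|//] := eqVneq q i.
    by rewrite ltnn item_weight_setU1 // ui mulr1.
  - case: eqP => // _; apply/setP => u; rewrite !inE ltn_ordS.
    by have [->|] := eqVneq u i; rewrite ?ui.
  - rewrite ltn_ordS; have [->|//] := eqVneq q i.
    by rewrite ltnn item_weight_setU1 // ui mulr0 expR0 mulr1.
rewrite /state_of /=; congr State.
- by apply/setP => q; rewrite !inE negb_or.
- apply/ffunP => q; rewrite !ffunE !inE; case: eqP => [->|] //=.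
  by apply/setP => u; rewrite !inE ltn_ord andbT.
- by apply/ffunP => u; rewrite !ffunE ltn_ord.
Qed.

(** * Running time and termination *)

Lemma compute_bound_cost : ((compute_bound I).2 <= 1 + m * 3)%N.
Proof.
rewrite /compute_bound /= leq_add2l.
by apply: for_each_ord_cost => u b /=; case: ifP.
Qed.

Lemma init_state_cost :
  ((init_state I).2 <= n * 2 + (n * 2 + (n * (m * 2).+1 + m * 3)))%N.
Proof.
rewrite /init_state /= addn0.
apply: leq_add; last (apply: leq_add; last apply: leq_add);
  apply: for_each_ord_cost => //.
by move=> r g; apply: for_each_ord_cost.
Qed.

Lemma continue_cost b st :
  ((continue eps I b st).2 <= n * 3 + (m * 3 + 5))%N.
Proof.
rewrite /continue /=; apply: leq_add; last apply: leq_add => //;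
  exact: for_each_ord_cost.
Qed.

Lemma unit_price_cost st r : ((unit_price I st r).2 <= m * 3 + 2)%N.
Proof.
rewrite /unit_price /=; apply: leq_add => //.
by apply: for_each_ord_cost => u x /=; case: ifP.
Qed.

Lemma best_request_cost st :
  ((best_request I st).2 <= n * (m * 3 + 6))%N.
Proof.
rewrite addnS; apply: for_each_ord_cost => r o /=.
case: ifP => _ /=; last by lia.
have := unit_price_cost st r.
case: o => [[q p]|] /=; last by lia.
by case: ifP => /= _; lia.
Qed.

Lemma select_cost b st :
  ((select eps I b st).2 <= n * (m * 3 + 6) + (m * 8 + 2))%N.
Proof.
rewrite /select /=; apply: leq_add; first exact: best_request_cost.
case: (best_request _ _).1 => [[r p]|] //=; apply: leq_add => //.
by apply: for_each_ord_cost => u s /=; case: ifP.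
Qed.

Definition round_cost : nat :=
  (n * 3 + (m * 3 + 5) + (n * (m * 3 + 6) + (m * 8 + 2))).+1.

(** Each round removes one pending request, so there are at most [#|~: W|] rounds; the extra
    [round_cost] pays for the last, failing test. *)
Lemma while_loop_greedy W st t :
  while_loop (continue eps I B) (select eps I B) (state_of W) st t ->
  (t <= #|~: W|.+1 * round_cost)%N /\
  exists2 W', st = state_of W' & greedy W W'.
Proof.
move eqs : (state_of W) => s run.
elim: run W eqs => [{}s k ck|{}s s1 s' k k1 k' ck bk _ IH] W eqs; subst s;
  have := continue_val W; have := continue_cost B (state_of W);
  rewrite ck => /= le_k /esym actW.
  split; last by exists W => //; apply: Greedy_stop; rewrite actW.
  by rewrite mulSn /round_cost; lia.
have [WT _] := andP actW; have [r br] := select_val WT.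
have := select_cost B (state_of W); rewrite bk => /= le_k1 eqs1.
have [le_k' [W' -> gr]] := IH _ (esym eqs1).
split; last by exists W' => //; apply: Greedy_step gr.
suff eqC : #|~: W| = #|~: (r |: W)|.+1.
  rewrite eqC mulSn -addSn; apply: leq_add le_k'.
  by rewrite ltnS leq_add.
by rewrite setCU setIC -setDE (cardsD1 r (~: W)) inE br.1.
Qed.

Lemma while_loop_exists W :
  exists st t, while_loop (continue eps I B) (select eps I B) (state_of W) st t.
Proof.
have [k] := ubnP #|~: W|; elim: k W => // k IH W; rewrite ltnS => leW.
case c : (continue eps I B (state_of W)) (continue_val W) => [b t] /= eqb.
case: b c eqb => c eqb; last by exists (state_of W), t.+1; apply: While_stop.
have [WT _] := andP (esym eqb); have [r [rW _]] := select_val WT.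
case s : (select eps I B (state_of W)) => [st1 t1] /= eqs1.
have [|st [t' run]] := IH (r |: W).
  apply: leq_trans leW; apply: proper_card.
  by rewrite properC properUr // sub1set.
by exists st, (t + t1 + t').+1; apply: While_step c s _; rewrite eqs1.
Qed.

End Semantics.

(** * Monotonicity *)

Lemma greedy_subset (R : realType) (m n : nat) (eps : R) (I : instance R m n)
    (W W' : {set 'I_n}) :
  greedy eps I W W' -> W \subset W'.
Proof. by elim=> // {}W r {}W' _ _ _; apply: subset_trans (subsetUr _ _). Qed.

Lemma min_mult_eq (R : realType) (m n : nat) (I I' : instance R m n) :
  mult I' =1 mult I -> min_mult I' = min_mult I.
Proof.
have le (J J' : instance R m n) : mult J' =1 mult J ->
    (min_mult J' <= min_mult J)%N.
  by move=> eqm; rewrite [leqRHS]/min_mult -eqm min_mult_le.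
by move=> eqm; apply/eqP; rewrite eqn_leq !le.
Qed.

Section Monotonicity.
Variables (R : realType) (m n : nat) (eps : R) (I I' : instance R m n) (r : 'I_n).
Hypotheses (eq_mult : mult I' =1 mult I) (eq_bundle : bundle I' =1 bundle I).
Hypotheses (eq_value : forall q, q != r -> value I' q = value I q).
Hypotheses (le_value : value I r <= value I' r).

(** Once the winners are fixed, the values enter neither the weights nor the stopping test; only the
    price of [r] changes. *)
Lemma item_weight_eq W u : item_weight eps I' W u = item_weight eps I W u.
Proof.
rewrite /item_weight /load (min_mult_eq eq_mult) eq_mult.
by under eq_finset do rewrite eq_bundle.
Qed.

Lemma active_eq W : active eps I' W = active eps I W.
Proof.
rewrite /active /potential (min_mult_eq eq_mult).
by under eq_bigr do rewrite eq_mult item_weight_eq.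
Qed.

Lemma price_eq W q : q != r -> price eps I' W q = price eps I W q.
Proof.
move=> qr; rewrite /price eq_value // eq_bundle.
by under eq_bigr do rewrite item_weight_eq.
Qed.

Lemma price_le W : price eps I' W r <= price eps I W r.
Proof.
rewrite /price eq_bundle; under eq_bigr do rewrite item_weight_eq.
apply: ler_wpM2r; last by rewrite lef_pV2 ?posrE ?value_gt0.
by apply: sumr_ge0 => u _; rewrite mulr_ge0 ?invr_ge0 ?expR_ge0.
Qed.

(** Passing to [I'] can only lower the price of [r]: comparisons between other requests are
    unchanged, and those won by [r] stay won. *)
Lemma best_eq W q q' :
  best eps I W q -> best eps I' W q' -> q' = r \/ q = q'.
Proof.
move=> [qW minq] [q'W minq']; have [->|q'r] := eqVneq q' r; first by left.
right; apply/val_inj/eqP; rewrite eqn_leq.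
have := minq' q qW; have := minq q' q'W; rewrite (price_eq W q'r).
have [->|qr] := eqVneq q r; last rewrite (price_eq W qr).
  have := price_le W.
  by move=> le_p [lt1|[eq1 le1]] [lt2|[eq2 le2]]; rewrite ?le1 ?le2 //; lra.
by move=> [lt1|[eq1 le1]] [lt2|[eq2 le2]]; rewrite ?le1 ?le2 //; lra.
Qed.

(* The runs agree until the one on [I'] selects [r]. *)
Lemma greedy_monotone W V V' :
  greedy eps I W V -> greedy eps I' W V' -> r \notin W -> r \in V -> r \in V'.
Proof.
move=> gr; elim: gr V' => [{}W _ V' _ /negPf-> //|{}W q {}V aW bq _ IH V' gr'].
case: {W V'} gr' aW bq IH => [W|W q' V' _ bq' gr'] => [|_ bq IH rW rV].
  by rewrite active_eq => /negbTE->.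
have [eqr|eqq] := best_eq bq bq'.
  by rewrite (subsetP (greedy_subset gr')) // eqr setU11.
have [eqr|qr] := eqVneq q' r.
  by rewrite (subsetP (greedy_subset gr')) // eqr setU11.
by apply: (IH _ _ _ rV); rewrite eqq // !inE eq_sym (negPf qr).
Qed.

End Monotonicity.

(** * Feasibility and weak duality *)

Lemma load_le (R : realType) (m n : nat) (I : instance R m n) W u :
  feasible I W -> (load I W u <= mult I u)%N.
Proof. by move=> /forallP /(_ u). Qed.

Section Approximation.
Variables (R : realType) (m n : nat) (eps : R) (I : instance R m n).
Hypothesis eps_gt0 : 0 < eps.

Local Notation Bound := ((min_mult I)%:R : R).

Lemma mult_gt0R u : 0 < (mult I u)%:R :> R.
Proof. by rewrite ltr0n mult_gt0. Qed.

Lemma min_mult_gt0 : 0 < Bound.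
Proof. exact: mult_gt0R. Qed.

Lemma item_weight_gt0 W u : 0 < item_weight eps I W u.
Proof. by rewrite mulr_gt0 ?invr_gt0 ?mult_gt0R ?expR_gt0. Qed.

Lemma mult_item_weight W u :
  (mult I u)%:R * item_weight eps I W u =
  expR (eps * Bound / (mult I u)%:R * (load I W u)%:R).
Proof. by rewrite /item_weight mulVKf // gt_eqF ?mult_gt0R. Qed.

Lemma mult_item_weight_le W u :
  (mult I u)%:R * item_weight eps I W u <= potential eps I W.
Proof.
rewrite /potential (bigD1 u) //= lerDl sumr_ge0 // => v _.
by rewrite mult_item_weight expR_ge0.
Qed.

Lemma potential_gt0 W : 0 < potential eps I W.
Proof.
apply: lt_le_trans (mult_item_weight_le W (item0 I)).
by rewrite mult_item_weight expR_gt0.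
Qed.

Lemma potential_set0 : potential eps I set0 = m%:R.
Proof.
rewrite /potential; under eq_bigr => u _.
  rewrite mult_item_weight load_set0 mulr0 expR0; over.
by rewrite sumr_const card_ord.
Qed.

(* A saturated item alone pushes the potential above the stopping threshold. *)
Lemma active_load W u : active eps I W -> (load I W u < mult I u)%N.
Proof.
move=> /andP[_ lowW]; rewrite ltnNge; apply/negP => sat.
have := le_trans (mult_item_weight_le W u) lowW.
rewrite mult_item_weight ler_expR; apply/negP; rewrite -ltNge.
have B0 := min_mult_gt0; have c0 := mult_gt0R u.
(* [eps (B - 1) < eps B], and the exponent of a saturated item is at least [eps B] since its load is
   at least [c_u]. *)
apply: (@lt_le_trans _ _ (eps * Bound)); first by rewrite ltr_pM2l //; lra.
rewrite -[leRHS]mulrA; apply: ler_peMr; first by rewrite mulr_ge0 ?ltW.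
by rewrite mulrC ler_pdivlMr // mul1r ler_nat.
Qed.

(** Every item has spare capacity when a round begins, so a single further request cannot overload
    it. *)
Lemma greedy_feasible W W' :
  greedy eps I W W' -> feasible I W -> feasible I W'.
Proof.
elim=> // {}W r {}W' aW [rW _] _ IH _; apply: IH; apply/forallP => u.
rewrite -[#|_|]/(load I (r |: W) u) load_setU1 //.
by have := active_load u aW; case: (_ \in _) => /=; lia.
Qed.

Lemma value_price W r :
  value I r * price eps I W r = \sum_(u in bundle I r) item_weight eps I W u.
Proof. by rewrite mulVKf // gt_eqF ?value_gt0. Qed.

Lemma price_ge0 W r : 0 <= price eps I W r.
Proof.
apply: mulr_ge0; first by rewrite invr_ge0 ltW ?value_gt0.
by apply: sumr_ge0 => u _; rewrite ltW ?item_weight_gt0.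
Qed.

(* Weak duality: scaling the weights by the inverse of the best price, and
   charging the requests already won in full, gives a feasible dual solution. *)
Lemma dual_bound W S r :
  feasible I S -> best eps I W r ->
  (total_value I S - total_value I W) * price eps I W r <= potential eps I W.
Proof.
move=> fS [_ minr].
(* The value of [W] covers that of [S :&: W]; only the requests of [S] outside [W] remain to be
   charged. *)
have le1 : total_value I S - total_value I W <= \sum_(q in S :\: W) value I q.
  rewrite lerBlDl /total_value (big_setID W) lerD2r [leRHS](big_setID S) /=.
  by rewrite setIC lerDl sumr_ge0 // => q _; rewrite ltW ?value_gt0.
apply: (le_trans (ler_wpM2r (price_ge0 W r) le1)).
rewrite mulr_suml; apply: (@le_trans _ _
  (\sum_(q in S) \sum_(u in bundle I q) item_weight eps I W u)).
  rewrite [leRHS](big_setID W) ler_wpDl //.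
    by do 2![apply: sumr_ge0 => ? _]; rewrite ltW ?item_weight_gt0.
  apply: ler_sum => q; rewrite inE => /andP[qW _]; rewrite -value_price.
  apply: ler_wpM2l; first by rewrite ltW ?value_gt0.
  by case: (minr q qW) => [/ltW|[-> _]].
under eq_bigr do rewrite big_mkcond.
(* Summed by items, the weight of [u] is counted [load S u <= c_u] times, as [S] is feasible. *)
rewrite exchange_big /=; apply: ler_sum => u _.
rewrite (eq_bigr (fun q => (u \in bundle I q)%:R * item_weight eps I W u));
  last by move=> q _; case: (u \in _); rewrite ?mul1r ?mul0r.
rewrite -mulr_suml -natr_sum -load_sum ler_wpM2r ?ler_nat ?load_le //.
by rewrite ltW ?item_weight_gt0.
Qed.

End Approximation.

(** * The approximation guarantee *)

(** This is the reciprocal of [1 - x <= exp (- x)]. *)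
Lemma expR_le_inv (R : realType) (x : R) : x < 1 -> expR x <= (1 - x)^-1.
Proof.
move=> x1; rewrite -[leLHS]invrK -expRN lef_pV2 ?posrE ?expR_gt0 ?subr_gt0 //.
exact: expR_ge1Dx.
Qed.

Lemma expR_le_linear (R : realType) (x a : R) :
  0 <= x -> x <= a -> a < 1 -> expR x <= 1 + x / (1 - a).
Proof.
move=> x0 xa a1; apply: (le_trans (expR_le_inv (le_lt_trans xa a1))).
have -> : (1 - x)^-1 = 1 + x / (1 - x) by field; rewrite gt_eqF //; lra.
by rewrite lerD2l ler_wpM2l // lef_pV2 ?posrE; lra.
Qed.

(** * Growth of the logarithm of the potential *)

Section Growth.
Variables (R : realType) (m n : nat) (eps : R) (I : instance R m n).

Local Notation Bound := ((min_mult I)%:R : R).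

Implicit Types W S : {set 'I_n}.

Let K : R := eps * Bound / (1 - eps).

(** For [u] in the bundle, [c_u y_u] is multiplied by [exp x] with [x = eps B / c_u <= eps], since
    [B <= c_u]. By the linear bound on [exp] it grows by at most [K y_u], and these [y_u] sum to
    value times price. *)
Lemma potential_setU1 W r : 0 < eps -> eps < 1 -> r \notin W ->
  potential eps I (r |: W) <=
  potential eps I W + K * (value I r * price eps I W r).
Proof.
move=> eps_gt0 eps_lt1 rW; rewrite value_price // big_mkcond mulr_sumr -big_split /=.
apply: ler_sum => u _; rewrite item_weight_setU1 //.
have w0 := item_weight_gt0 eps I W u; set w := item_weight _ _ _ _ in w0 *.
case: (u \in _); last by rewrite mulr0 expR0 mulr1 mulr0 addr0.
have c0 := mult_gt0R I u; have B0 := min_mult_gt0 I.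
have Bc : Bound <= (mult I u)%:R by rewrite ler_nat min_mult_le.
rewrite mulr1; set c := (mult I u)%:R in c0 Bc *; set x := eps * _ / c.
have x0 : 0 <= x by rewrite divr_ge0 ?mulr_ge0 ?ltW.
have xe : x <= eps by rewrite ler_pdivrMr // ler_pM2l.
have ex : expR x <= 1 + x / (1 - eps) by exact: expR_le_linear.
have -> : c * w + K * w = c * w * (1 + x / (1 - eps)).
  by rewrite /K /x; field; rewrite !gt_eqF ?subr_gt0 ?mult_gt0R.
by rewrite mulrA ler_wpM2l // mulr_ge0 ?ltW.
Qed.

Lemma total_value_ge0 W : 0 <= total_value I W.
Proof. by apply: sumr_ge0 => r _; rewrite ltW ?value_gt0. Qed.

Lemma total_value_setU1 (W : {set 'I_n}) r : r \notin W ->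
  total_value I (r |: W) = value I r + total_value I W.
Proof. by move=> rW; rewrite /total_value big_setU1. Qed.

Lemma total_value_subset (W W' : {set 'I_n}) :
  W \subset W' -> total_value I W <= total_value I W'.
Proof.
move=> /setIidPr sub; rewrite /total_value [leRHS](big_setID W) /= sub.
by rewrite lerDl sumr_ge0 // => r _; rewrite ltW ?value_gt0.
Qed.

(* With [D], [P] the potential and the value before, [D'] the potential after,
   [v] the value of [r] and [T] that of [S]: [ln D' - ln D <= K v / (T - P)
   <= K (ln (T - P) - ln (T - P - v))]. *)
Lemma ln_potential_setU1 S W r : 0 < eps -> eps < 1 ->
  feasible I S -> best eps I W r ->
  total_value I (r |: W) < total_value I S ->
  ln (potential eps I (r |: W)) <= ln (potential eps I W) +
    K * (ln (total_value I S - total_value I W) -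
         ln (total_value I S - total_value I (r |: W))).
Proof.
move=> eps_gt0 eps_lt1 fS br; have [rW _] := br; rewrite total_value_setU1 // => ltT.
have dual := dual_bound fS br; have growth := potential_setU1 eps_gt0 eps_lt1 rW.
have D0 := potential_gt0 eps I W; have D0' := potential_gt0 eps I (r |: W).
have v0 := value_gt0 I r; have B0 := min_mult_gt0 I.
set T := total_value I S in ltT dual *; set P := total_value I W in ltT dual *.
set v := value I r in v0 growth ltT *; set p := price _ _ _ _ in dual growth.
set D := potential eps I W in D0 dual growth *.
have K0 : 0 <= K by rewrite divr_ge0 ?mulr_ge0 ?subr_ge0 ?ltW.
have TP : 0 < T - P by lra.
have TPv : 0 < T - (v + P) by lra.
(* Weak duality bounds the price from above; [1 + z <= exp z] then turns the increase of [D] into a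
   factor. *)
have le_p : p <= D / (T - P) by rewrite ler_pdivlMr // mulrC.
have le_D' : potential eps I (r |: W) <= D * expR (K * (v / (T - P))).
  apply: (le_trans growth); apply: (@le_trans _ _ (D * (1 + K * (v / (T - P))))).
    rewrite mulrDr mulr1 lerD2l.
    have -> : D * (K * (v / (T - P))) = K * (v * (D / (T - P))) by ring.
    by rewrite ler_wpM2l // ler_wpM2l // ltW.
  by rewrite ler_wpM2l ?expR_ge1Dx // ltW.
apply: (@le_trans _ _ (ln D + K * (v / (T - P)))).
  rewrite -[X in _ + X]expRK -lnM ?posrE ?expR_gt0 //.
  by rewrite ler_ln ?posrE ?mulr_gt0 ?expR_gt0.
rewrite lerD2l ler_wpM2l // -ln_div ?posrE //.
rewrite -ler_expR lnK ?posrE ?divr_gt0 //.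
(* With [x = v / (T - P)], [exp x <= 1 / (1 - x) = (T - P) / (T - P - v)]. *)
have lt1 : v / (T - P) < 1 by rewrite ltr_pdivrMr //; lra.
apply: (le_trans (expR_le_inv lt1)).
rewrite le_eqVlt; apply/orP; left; apply/eqP; field.
by rewrite !gt_eqF //; lra.
Qed.

(** Winners only accumulate, so [T - P] stays positive throughout the run and the bounds for single
    rounds telescope. *)
Lemma greedy_ln_potential S W W' : 0 < eps -> eps < 1 ->
  feasible I S -> greedy eps I W W' -> total_value I W' < total_value I S ->
  ln (potential eps I W') <= ln (potential eps I W) +
    K * (ln (total_value I S - total_value I W) -
         ln (total_value I S - total_value I W')).
Proof.
move=> eps_gt0 eps_lt1 fS gr; elim: gr => [{}W _ _|{}W r {}W' _ br gr IH ltT].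
  by rewrite subrr mulr0 addr0.
have ltT1 := le_lt_trans (total_value_subset (greedy_subset gr)) ltT.
by have := IH ltT; have := ln_potential_setU1 eps_gt0 eps_lt1 fS br ltT1; lra.
Qed.

End Growth.

(** * From the stopping rule to the approximation ratio *)

Lemma ln2_ge_half (R : realType) : 2^-1 <= ln 2 :> R.
Proof.
rewrite -ler_expR lnK ?posrE //; apply: le_trans (expR_le_inv _) _; first by lra.
by rewrite (_ : 1 - 2^-1 = 2^-1) ?invrK //; lra.
Qed.

Section Guarantee.
Variables (R : realType) (m n : nat) (eps : R) (I : instance R m n).

Local Notation Bound := ((min_mult I)%:R : R).

(* For [m = 1] the potential is [exp (eps / 6 * load)], so exceeding the
   threshold forces [load >= B], even though [B] need not be large.  For
   [m >= 2] both [ln m] and [eps / 6] are at most [eps ^ 2 B / 144]. *)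
Lemma stop_ln_potential W :
  0 < eps -> eps <= 1 -> 144 * (ln m%:R / eps ^+ 2) <= Bound ->
  expR (eps / 6 * (Bound - 1)) < potential (eps / 6) I W ->
  ln m%:R + eps / 6 * Bound * (1 - eps / 12) <= ln (potential (eps / 6) I W).
Proof.
move=> eps_gt0 eps_le1 large stop; have B0 := min_mult_gt0 I.
have [m1|m2] : (m = 1 \/ 2 <= m)%N by have := items_gt0 I; lia.
  have allu u : u = item0 I by apply/val_inj; case: u => u; rewrite /= m1; lia.
  have c_B : mult I (item0 I) = min_mult I by rewrite /min_mult [arg_min _ _ _]allu.
  have potE : potential (eps / 6) I W = expR (eps / 6 * (load I W (item0 I))%:R).
    rewrite /potential (bigD1 (item0 I)) //= big1 => [|u]; last first.
      by rewrite [u]allu eqxx.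
    rewrite addr0 mult_item_weight // c_B; congr expR; field.
    by rewrite gt_eqF.
  move: stop; rewrite potE expRK ltr_expR ltr_pM2l; last by rewrite divr_gt0.
  rewrite ltrBlDr natr1 ltr_nat ltnS -(ler_nat R) => le_B.
  have -> : ln m%:R = 0 :> R by rewrite m1 ln1.
  rewrite add0r -mulrA ler_pM2l ?divr_gt0 //; apply: le_trans le_B.
  by rewrite ler_piMr ?ltW //; lra.
have lnD : eps / 6 * (Bound - 1) <= ln (potential (eps / 6) I W).
  by rewrite -ler_expR lnK ?posrE ?ltW // potential_gt0.
(* This forces [eps ^ 2 B >= 72], which absorbs the [eps / 6] lost to [B - 1] in the threshold. *)
have ln2m : 2^-1 <= ln m%:R :> R.
  apply: le_trans (ln2_ge_half R) _; rewrite ler_ln ?posrE ?ltr0n ?ler_nat //.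
  exact: ltnW.
have large' : 144 * ln m%:R <= Bound * eps ^+ 2.
  by rewrite -ler_pdivrMr ?exprn_gt0 // -mulrA.
by apply: le_trans lnD; rewrite expr2 in large'; lra.
Qed.

Lemma greedy_value W S :
  0 < eps -> eps <= 1 -> 144 * (ln m%:R / eps ^+ 2) <= Bound ->
  feasible I S -> greedy (eps / 6) I set0 W ->
  total_value I S <= (1 + eps) * (expR 1 / (expR 1 - 1)) * total_value I W.
Proof.
move=> eps_gt0 eps_le1 large fS gr.
have e2 : 2 <= expR 1 :> R by apply: le_trans (expR_ge1Dx 1); lra.
have rho1 : 1 <= (1 + eps) * (expR 1 / (expR 1 - 1)) :> R.
  by rewrite mulrA ler_pdivlMr; [nra | lra].
have [leT|ltT] := lerP (total_value I S) (total_value I W).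
  by apply: (le_trans leT); rewrite ler_peMl ?total_value_ge0.
(* A run that ends below the threshold has no request left, so it has won everything, against
   [ltT]. *)
have stop : expR (eps / 6 * (Bound - 1)) < potential (eps / 6) I W.
  rewrite ltNge; apply/negP => low.
  have : ~~ active (eps / 6) I W by elim: gr.
  rewrite /active low andbT negbK => /eqP WT.
  by move: ltT; rewrite WT ltNge total_value_subset ?subsetT.
have e6 : 0 < eps / 6 by lra.
have e61 : eps / 6 < 1 by lra.
have := greedy_ln_potential e6 e61 fS gr ltT.
have := stop_ln_potential eps_gt0 eps_le1 large stop; rewrite potential_set0.
have -> : total_value I set0 = 0 by rewrite /total_value big_set0.
rewrite subr0; have T0 := le_lt_trans (total_value_ge0 I W) ltT.
have B0 := min_mult_gt0 I.
set T := total_value I S in ltT T0 *; set P := total_value I W in ltT *.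
have TP : 0 < T - P by lra.
move=> lo up; set L := ln T - ln (T - P) in up.
(* Dividing by [K] gives [L >= (1 - eps / 6) (1 - eps / 12) >= 1 - eps / 4]. *)
have leL : 1 - eps / 4 <= L.
  have : eps / 6 * Bound * (1 - eps / 12) <= eps / 6 * Bound / (1 - eps / 6) * L.
    by lra.
  rewrite -[leRHS]mulrA ler_pM2l ?mulr_gt0 ?invr_gt0 // ler_pdivlMl; last by lra.
  by nra.
have : T - P <= T * expR (eps / 4 - 1).
  rewrite -[leLHS]lnK ?posrE // -[X in X * _]lnK ?posrE // -expRD ler_expR.
  by rewrite /L in leL; lra.
rewrite expRD expRN => leTP.
(* [(1 + eps / 3) (1 - eps / 4) = 1 + eps (1 - eps) / 12 >= 1]. *)
have eq4 : expR (eps / 4) <= 1 + eps / 3.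
  apply: (le_trans (expR_le_inv _)); first by lra.
  by rewrite -[_^-1]mul1r ler_pdivrMr; [nra | lra].
have : T - P <= T * ((1 + eps / 3) / expR 1).
  apply: (le_trans leTP); apply: ler_wpM2l; first exact: ltW.
  apply: ler_wpM2r => //.
  by rewrite invr_ge0; lra.
set E := expR 1 in e2 *; rewrite mulrA ler_pdivlMr; last by lra.
move=> leE; have leT : T * (E - 1 - eps / 3) <= P * E by lra.
have -> : (1 + eps) * (E / (E - 1)) * P = (1 + eps) * (P * E) / (E - 1) by ring.
rewrite ler_pdivlMr; last by lra.
apply: le_trans (ler_wpM2l _ leT); last by lra.
(* It remains to see that [E - 1 <= (1 + eps) (E - 1 - eps / 3)], scaled by [T]; the difference of
   the two sides is this quantity plus [eps / 3]. *)
have : 0 <= eps / 3 * (1 - eps) + eps * (E - 2) by nra.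
by nra.
Qed.

End Guarantee.

Lemma greedy_approximate (R : realType) (m n : nat) (eps : R) (I : instance R m n)
    (W : {set 'I_n}) :
  0 < eps -> eps <= 1 -> 144 * (ln m%:R / eps ^+ 2) <= (min_mult I)%:R ->
  greedy (eps / 6) I set0 W ->
  approximate ((1 + eps) * (expR 1 / (expR 1 - 1))) I W.
Proof.
move=> eps_gt0 eps_le1 large gr; have e6 : 0 < eps / 6 by lra.
split.
  apply: (greedy_feasible e6 gr); apply/forallP => u.
  by rewrite -[#|_|]/(load I set0 u) load_set0.
have e2 : 2 <= expR 1 :> R by apply: le_trans (expR_ge1Dx 1); lra.
have rho_gt0 : 0 < (1 + eps) * (expR 1 / (expR 1 - 1)) :> R.
  by rewrite mulr_gt0 ?divr_gt0 ?expR_gt0; lra.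
rewrite mulrC ler_pdivrMr //; apply: bigmax_le => [|S fS].
  by rewrite mulr_ge0 ?total_value_ge0 // ltW.
by rewrite [leRHS]mulrC greedy_value.
Qed.

(** * The guarantees for the program itself *)

Section Outcome.
Variables (R : realType) (m n : nat) (eps : R) (I : instance R m n).

Lemma bounded_muca_exists : exists o t, bounded_muca eps I o t.
Proof.
have [st [t run]] := while_loop_exists eps I set0.
exists (Outcome (winners st) (granted st)).
exists ((compute_bound I).2 + (init_state I).2 + t)%N, st, t.
case: (compute_bound I) (compute_bound_val I) => b t1 eqb.
by case: (init_state I) (init_state_val eps I) => s t2 /= ->; move: eqb => /= ->.
Qed.

Lemma bounded_muca_greedy o t : bounded_muca eps I o t ->
  (t <= 100 * (m + n) ^ 3)%N /\
  exists2 W, o = Outcome W (grants I W) & greedy eps I set0 W.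
Proof.
move=> [st [t']]; have := compute_bound_cost I; have := init_state_cost I.
case: (compute_bound I) (compute_bound_val I) => b t1 eqb.
case: (init_state I) (init_state_val eps I) => s t2 /= -> le2 le1.
move: eqb => /= -> [run -> ->].
have [le3 [W -> gr]] := while_loop_greedy run; split; last by exists W.
move: le3; rewrite setC0 cardsT card_ord /round_cost => le3.
(* There are at most [n + 1] rounds of quadratic cost; [m >= 1] lets the cubic bound absorb the
   lower-order terms. *)
have m_gt0 := items_gt0 I; have [k eqm] : exists k, m = k.+1 by exists m.-1; lia.
move: le1 le2 le3; rewrite {}eqm !expnS expn0; clear; nia.
Qed.

End Outcome.

Theorem theorem5 (R : realType) :
  exists2 c : R, 0 < c &
  exists p : {poly nat},
  forall eps : R, 0 < eps <= 1 ->
  forall (m n : nat) (I : instance R m n),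
  c * (ln m%:R / eps ^+ 2) <= (min_mult I)%:R ->
  [/\ exists o t, bounded_muca (eps / 6) I o t,
      forall o t, bounded_muca (eps / 6) I o t ->
        [/\ approximate ((1 + eps) * (expR 1 / (expR 1 - 1))) I (selected o),
            (t <= p.[(m + n)%N])%N
          & exact_outcome I o]
    & forall r : 'I_n,
        monotone_at (fun J o => exists t, bounded_muca (eps / 6) J o t) I r].
Proof.
(* For [m >= 2], the constant 144 makes [ln m + eps / 6] at most [(eps / 6) B (eps / 12)], the loss
   allowed in [stop_ln_potential]. *)
exists 144 => //; exists (100%N *: 'X^3)%R => eps /andP[eps_gt0 eps_le1] m n I large.
split; first exact: bounded_muca_exists.
  move=> o t /bounded_muca_greedy[le_t [W -> gr]]; split=> /=.
  - exact: greedy_approximate.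
  - by rewrite hornerZ hornerXn.
  - by move=> r; rewrite ffunE; split=> [->|/negPf->].
move=> r I' eqm eqb eqv lev o o' [t run] [t' run'].
have [_ [W -> gr]] := bounded_muca_greedy run.
have [_ [W' -> gr']] := bounded_muca_greedy run'.
by apply: greedy_monotone gr gr' _; rewrite // inE.
Qed.
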